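(* Suppose there exists $t\ge2$ such that $\mathbb E[P_{<t}]>t-1$. If $\mathcal B^{rand}_{<t}=\emptyset$, then $\delta$-offset-expiry cannot be satisfied for any value of $\delta\in(0,1)$. Otherwise, $\delta$-offset-expiry cannot be satisfied for $$\delta<\frac12-\mathrm{Std}[P_{<t}]^{-3}\cdot T .$$
   Context: There are $T$ rounds and a set $\mathcal B$ of $B=T$ units of a resource, and exactly one individual arrives in each round almost surely ($N_t=1$ for all $t\in\{1,\dots,T\}$, so $N=T$). Unit $b\in\mathcal B$ has a random perishing time $T_b\in\{1,2,\dots\}$; the perishing times are i.i.d. across units. $P_{<t}=\sum_{b\in\mathcal B}\mathbf 1\{T_b<t\}$ and $\mathrm{Std}[\cdot]$ denotes standard deviation. $\mathcal B^{rand}_{<t}=\{b\in\mathcal B:\Pr(T_b<t)\in(0,1)\}$. For $\delta\in(0,1)$, the perishing process is $\delta$-offset-expiring (satisfies $\delta$-offset-expiry) if $\Pr\left(\frac{P_{<t}}{B}\le\frac{N_{<t}}{N}\ \forall t\ge2\right)\ge1-\delta$ with $N_{<t}=\sum_{t'<t}N_{t'}$, i.e. here, if $\Pr(P_{<t}\le t-1\ \forall t\in\{2,\dots,T\})\ge1-\delta$. *)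

(* Defs.v *)
From HB Require Import structures.
From mathcomp Require Export all_boot all_order all_algebra.
From mathcomp Require Export all_classical all_reals all_analysis.

#[export] Set Implicit Arguments.
#[export] Unset Strict Implicit.
#[export] Unset Printing Implicit Defensive.

Export Order.TTheory GRing.Theory Num.Theory.
Export numFieldNormedType.Exports.

Open Scope classical_set_scope.
Open Scope ring_scope.

Section IID.
Context {d d' : measure_display} {Omega : measurableType d}
  {S : measurableType d'} {R : realType} (P : probability Omega R).
Context {I : finType} (X : I -> {RV P >-> S}).

Definition mutually_independent : Prop :=
  forall (J : {set I}) (A : I -> set S), (forall i, measurable (A i)) ->
    P [set w | forall i, i \in J -> A i (X i w)]
    = (\prod_(i in J) P (X i @^-1` A i))%E.

Definition identically_distributed : Prop :=
  forall (i j : I) (A : set S), measurable A ->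
    distribution P (X i) A = distribution P (X j) A.

Definition iid : Prop := mutually_independent /\ identically_distributed.

End IID.

Definition std {d : measure_display} {Omega : measurableType d} {R : realType}
    (P : probability Omega R) (X : Omega -> R) : R :=
  Num.sqrt (fine ('V_P[X])%E).

(* Rounds are 1, ..., T; the finite type U is the set of resource units,
   perish b is the perishing time of unit b, and arr s is the number of
   arrivals in round s (its values at s = 0 and s > T are never used). *)
Section Perishing.
Context {d : measure_display} {Omega : measurableType d} {R : realType}
  (P : probability Omega R).
Context {U : finType}.

Definition perished_before (perish : U -> {RV P >-> nat}) (t : nat)
    (w : Omega) : nat :=
  (\sum_(b : U) (perish b w < t))%N.

Definition rand_units (perish : U -> {RV P >-> nat}) (t : nat) : set U :=
  [set b | (0 < P [set w | (perish b w < t)%N] < 1)%E].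

Definition arrivals_before (arr : nat -> {RV P >-> nat}) (t : nat)
    (w : Omega) : nat :=
  (\sum_(1 <= s < t) arr s w)%N.

Definition total_arrivals (T : nat) (arr : nat -> {RV P >-> nat})
    (w : Omega) : nat :=
  arrivals_before arr T.+1 w.

Definition offset_expiring (T : nat) (arr : nat -> {RV P >-> nat})
    (perish : U -> {RV P >-> nat}) (delta : R) : Prop :=
  ((1 - delta)%:E <=
   P [set w | forall t : nat, (2 <= t <= T)%N ->
       ((perished_before perish t w)%:R / #|U|%:R
        <= (arrivals_before arr t w)%:R / (total_arrivals T arr w)%:R :> R)%R])%E.

End Perishing.

(* Main.v *)
(* Let [X] be the number of units perished before [t]; it is binomial with
   parameters [n] and [p], and [k = t - 1] satisfies [k <= n p].  Offset expiry
   bounds [1 - delta] by [Pr(X <= k) = Pr(X < k) + Pr(X = k)].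
   Since [k] does not exceed the mean, [Pr(X < k) <= 1/2]: if [k <= n/2], the
   mass at [k - 1 - j] is at most the mass at [k + j]; if [k > n/2], the
   differences of the masses at [k + j] and [k - j] change sign at most once,
   from positive to negative, and have a nonnegative first moment [n p - k].
   De Moivre's formula for partial sums of the mean deviation expresses
   [(n + 1) p (1 - p) Pr(X = k)] as a partial sum bounded by the mean absolute
   deviation of a binomial with [n + 1] trials, whence
   [Pr(X = k) <= 1 / Std X <= n / (Std X)^3].  This replaces the Berry-Esseen
   theorem. *)
Require Import Defs.
From mathcomp Require Import measurable_realfun ring lra zify.

(** * Recurrences between binomial masses *)

Lemma binomial_pmfE (R : realType) (n : nat) (p : R) k :
  binomial_pmf n p k = 'C(n, k)%:R * p ^+ k * (1 - p) ^+ (n - k).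
Proof. by rewrite -mulrA mulr_natl. Qed.

Lemma binomial_pmf_gt (R : realType) (n : nat) (p : R) k :
  (n < k)%N -> binomial_pmf n p k = 0.
Proof. by move=> nk; rewrite /binomial_pmf bin_small. Qed.

Lemma binomial_pmfS_succ (R : realType) (n : nat) (p : R) k :
  k.+1%:R * binomial_pmf n.+1 p k.+1 = n.+1%:R * p * binomial_pmf n p k.
Proof.
rewrite !binomial_pmfE subSS exprS.
have : k.+1%:R * 'C(n.+1, k.+1)%:R = n.+1%:R * 'C(n, k)%:R :> R.
  by rewrite -!natrM mul_bin_diag.
move: 'C(n.+1, k.+1)%:R 'C(n, k)%:R (p ^+ k) ((1 - p) ^+ _) => c c' x y e.
by rewrite !mulrA e; ring.
Qed.

Lemma binomial_pmfS_fail (R : realType) (n : nat) (p : R) k : (k <= n)%N ->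
  (n - k)%:R * binomial_pmf n.+1 p k.+1
  = n.+1%:R * (1 - p) * binomial_pmf n p k.+1.
Proof.
rewrite leq_eqVlt => /predU1P[->|kn].
  by rewrite subnn mul0r binomial_pmf_gt ?mulr0.
rewrite !binomial_pmfE subSS -[(n - k)%N]prednK ?subn_gt0// -subnS.
rewrite (exprS (1 - p)).
have : (n - k.+1).+1%:R * 'C(n.+1, k.+1)%:R = n.+1%:R * 'C(n, k.+1)%:R :> R.
  by rewrite -!natrM subnSK// (mul_bin_down n.+1) subSS.
move: 'C(n.+1, k.+1)%:R 'C(n, k.+1)%:R (p ^+ k.+1) ((1 - p) ^+ (n - k.+1)).
move=> c c' x y e.
by rewrite !mulrA e; ring.
Qed.

(** Two expressions for the mass of [n.+1] trials at [k.+1] are compared, one from [n] trials at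
    [k], one from [n] trials at [k.+1]. The form without division also covers [p = 0] and
    [p = 1]. *)
Lemma binomial_pmf_ratio (R : realType) (n : nat) (p : R) k : (k <= n)%N ->
  k.+1%:R * (1 - p) * binomial_pmf n p k.+1
  = (n - k)%:R * p * binomial_pmf n p k.
Proof.
move=> kn; have n0 : n.+1%:R != 0 :> R by rewrite pnatr_eq0.
apply: (mulfI n0).
transitivity ((n - k)%:R * (k.+1%:R * binomial_pmf n.+1 p k.+1)).
  by rewrite [RHS]mulrCA binomial_pmfS_fail//; ring.
by rewrite binomial_pmfS_succ; ring.
Qed.

Lemma binomial_pmf_pascal (R : realType) (n : nat) (p : R) k : (k <= n)%N ->
  binomial_pmf n.+1 p k.+1
  = p * binomial_pmf n p k + (1 - p) * binomial_pmf n p k.+1.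
Proof.
move=> kn; have n0 : n.+1%:R != 0 :> R by rewrite pnatr_eq0.
apply: (mulfI n0).
have e1 := binomial_pmfS_succ n p k; have e2 := binomial_pmfS_fail p kn.
rewrite mulrDr !mulrA -e1 -e2 -mulrDl -natrD; congr (_%:R * _); lia.
Qed.

(** * Total mass and moments of the binomial law *)

Lemma binomial_pmf0 (R : realType) (n : nat) (p : R) :
  binomial_pmf n p 0 = (1 - p) ^+ n.
Proof. by rewrite /binomial_pmf bin0 subn0 expr0 mul1r mulr1n. Qed.

(** Conditioning on one trial: a success shifts the argument of [g] by one. This drives the
    inductions for the moments. *)
Lemma binomial_sumS (R : realType) (n : nat) (p : R) (g : nat -> R) :
  \sum_(k < n.+2) g k * binomial_pmf n.+1 p k
  = \sum_(k < n.+1) (p * g k.+1 + (1 - p) * g k) * binomial_pmf n p k.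
Proof.
rewrite big_ord_recl binomial_pmf0 exprS -binomial_pmf0.
rewrite (eq_bigr (fun k : 'I_n.+1 => p * g k.+1 * binomial_pmf n p k
    + (1 - p) * (g k.+1 * binomial_pmf n p k.+1))) => [|k _]; last first.
  by rewrite lift0 binomial_pmf_pascal -1?ltnS//; ring.
rewrite big_split/= addrCA.
under [RHS]eq_bigr do rewrite mulrDl.
rewrite big_split/=; congr (_ + _).
under [RHS]eq_bigr do rewrite -mulrA.
rewrite -!mulr_sumr mulrCA -mulrDr; congr (_ * _).
rewrite big_ord_recr/= [X in _ + (_ + g n.+1 * X)]binomial_pmf_gt//.
rewrite mulr0 addr0 [RHS]big_ord_recl; congr (_ + _).
Qed.

Lemma binomial_sum1 (R : realType) (n : nat) (p : R) :
  \sum_(k < n.+1) binomial_pmf n p k = 1.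
Proof.
elim: n => [|n IH]; first by rewrite big_ord1 binomial_pmf0 expr0.
under eq_bigr do rewrite -[binomial_pmf _ _ _]mul1r.
rewrite (binomial_sumS n p (fun=> 1)) -[RHS]IH.
by apply: eq_bigr => k _ /=; ring.
Qed.

(** The centre [c] stays free because a success turns [k - c] into [k - (c - 1)]; the induction uses
    both centres. *)
Lemma binomial_mean (R : realType) (n : nat) (p c : R) :
  \sum_(k < n.+1) (k%:R - c) * binomial_pmf n p k = n%:R * p - c.
Proof.
elim: n c => [|n IH] c; first by rewrite big_ord1 binomial_pmf0 expr0 /=; ring.
rewrite (binomial_sumS n p (fun k => k%:R - c)).
transitivity (p * \sum_(k < n.+1) (k%:R - (c - 1)) * binomial_pmf n p k
   + (1 - p) * \sum_(k < n.+1) (k%:R - c) * binomial_pmf n p k).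
  rewrite !mulr_sumr -big_split/=; apply: eq_bigr => k _.
  by rewrite -natr1; ring.
by rewrite !IH -natr1; ring.
Qed.

Lemma binomial_variance (R : realType) (n : nat) (p c : R) :
  \sum_(k < n.+1) (k%:R - c) ^+ 2 * binomial_pmf n p k
  = n%:R * p * (1 - p) + (n%:R * p - c) ^+ 2.
Proof.
elim: n c => [|n IH] c; first by rewrite big_ord1 binomial_pmf0 expr0 /=; ring.
rewrite (binomial_sumS n p (fun k => (k%:R - c) ^+ 2)).
transitivity (p * \sum_(k < n.+1) (k%:R - (c - 1)) ^+ 2 * binomial_pmf n p k
   + (1 - p) * \sum_(k < n.+1) (k%:R - c) ^+ 2 * binomial_pmf n p k).
  rewrite !mulr_sumr -big_split/=; apply: eq_bigr => k _.
  by rewrite -natr1; ring.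
by rewrite !IH -natr1; ring.
Qed.

(** * De Moivre's formula and the bound on a single mass *)

Lemma binomial_partial_mean (R : realType) (n : nat) (p : R) k : (k <= n)%N ->
  \sum_(j < k.+1) (n.+1%:R * p - j%:R) * binomial_pmf n.+1 p j
  = n.+1%:R * p * (1 - p) * binomial_pmf n p k.
Proof.
elim: k => [_|k IH kn].
  by rewrite big_ord1 !binomial_pmf0 exprS /=; ring.
rewrite big_ord_recr/= IH 1?ltnW//.
have e1 := binomial_pmfS_succ n p k.
have e2 := binomial_pmfS_fail p (ltnW kn).
(* By [e1] and [e2] the new summand is [(n + 1) p (1 - p)] times the increment of the mass of [n]
   trials from [k] to [k + 1], so the sum telescopes. *)
have -> : (n.+1%:R * p - k.+1%:R) * binomial_pmf n.+1 p k.+1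
    = p * ((n - k)%:R * binomial_pmf n.+1 p k.+1)
      - (1 - p) * (k.+1%:R * binomial_pmf n.+1 p k.+1).
  by rewrite natrB 1?ltnW// -!natr1; ring.
by rewrite e1 e2; ring.
Qed.

Lemma binomial_pmf_le (R : realType) (n : nat) (p : R) k :
  (0 < n)%N -> 0 < p < 1 -> (k <= n)%N ->
  binomial_pmf n p k <= (Num.sqrt (n%:R * p * (1 - p)))^-1.
Proof.
move=> n0 /andP[p0 p1] kn.
set v := n.+1%:R * p * (1 - p).
have v0 : 0 < v by rewrite !mulr_gt0 ?subr_gt0.
set s := Num.sqrt v.
have s0 : 0 < s by rewrite sqrtr_gt0.
have sE : s ^+ 2 = v by rewrite sqr_sqrtr ?ltW.
have w0 : 0 < n%:R * p * (1 - p) by rewrite !mulr_gt0 ?ltr0n ?subr_gt0.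
have b0 j : 0 <= binomial_pmf n.+1 p j by rewrite binomial_pmf_ge0// !ltW.
(* The variance [v] of [n.+1] trials exceeds that of [n], so [s^-1] is the stronger bound. *)
apply: (@le_trans _ _ s^-1); last first.
  rewrite lef_pV2 ?posrE ?sqrtr_gt0//; apply: ler_wsqrtr.
  by rewrite /v !ler_pM2r ?subr_gt0// ler_nat.
rewrite -(ler_pM2l v0) -binomial_partial_mean//.
rewrite -[X in X / s]sE expr2 mulfK ?gt_eqF//.
(* AM-GM: [x <= (s + x ^ 2 / s) / 2] *)
apply: (@le_trans _ _ (\sum_(j < n.+2)
    (s / 2 + (j%:R - n.+1%:R * p) ^+ 2 / (2 * s)) * binomial_pmf n.+1 p j)).
  have amgm (x : R) : x <= s / 2 + x ^+ 2 / (2 * s).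
    rewrite -subr_ge0.
    have -> : s / 2 + x ^+ 2 / (2 * s) - x = (x - s) ^+ 2 / (2 * s).
      by field; rewrite gt_eqF.
    by rewrite divr_ge0 ?sqr_ge0// mulr_ge0// ltW.
  (* The partial sum is padded with zeros up to [n.+1]; the majorant is nonnegative there. *)
  rewrite (big_ord_widen_cond n.+2 xpredT
    (fun j => (n.+1%:R * p - j%:R) * binomial_pmf n.+1 p j)) ?ltnS ?leqW//.
  rewrite big_mkcond/=; apply: ler_sum => j _.
  case: ifPn => _; first by rewrite ler_wpM2r// -sqrrN opprB amgm.
  rewrite mulr_ge0// addr_ge0 ?divr_ge0 ?sqr_ge0// ltW//.
  by rewrite mulr_gt0.
(* The majorant has expectation [s / 2 + v / (2 s) = s]. *)
under eq_bigr do rewrite mulrDl [X in _ + X]mulrAC.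
rewrite big_split/= -mulr_sumr -mulr_suml binomial_variance binomial_sum1.
rewrite -/v -sE subrr le_eqVlt; apply/orP; left; apply/eqP.
by field; rewrite gt_eqF.
Qed.

(** * The mass strictly below an integer not exceeding the mean is at most one half *)

Lemma sum_ord_rev (V : nmodType) (k : nat) (g : nat -> V) :
  \sum_(m < k) g m = \sum_(j < k) g (k - j.+1)%N.
Proof. by rewrite (reindex_inj rev_ord_inj). Qed.

Lemma sum_ord_central (V : nmodType) (k : nat) (g : nat -> V) :
  \sum_(m < k.*2.+1) g m
  = g k + \sum_(j < k) (g (k + j.+1)%N + g (k - j.+1)%N).
Proof.
have -> : k.*2.+1 = (k + k.+1)%N by lia.
rewrite big_split_ord/= sum_ord_rev big_ord_recl/= addn0 addrCA.
by congr (_ + _); rewrite addrC big_split.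
Qed.

(** Induction on [j]: moving one step outwards multiplies the left mass by no more than the right
    one. *)
Lemma binomial_pmf_reflect (R : realType) (n k : nat) (p : R) (j : nat) :
  0 < p < 1 -> k%:R <= n%:R * p -> (k.*2 <= n)%N -> (j < k)%N ->
  binomial_pmf n p (k - j.+1) <= binomial_pmf n p (k + j).
Proof.
move=> /andP[p0 p1] knp k2n.
have q0 : 0 < 1 - p by rewrite subr_gt0.
have b0 i : 0 <= binomial_pmf n p i by rewrite binomial_pmf_ge0// !ltW.
have KX : k%:R <= n%:R - k%:R + 1 :> R.
  have : k.*2%:R <= n%:R :> R by rewrite ler_nat.
  by rewrite -mul2n natrM; lra.
(* For [j = 0], [k <= n p] gives [k (1 - p) <= (n - k + 1) p], so the mass does not drop from
   [k - 1] to [k]. *)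
elim: j => [k0|j IH jk].
  have := @binomial_pmf_ratio R n p (k - 1) ltac:(lia).
  rewrite addn0 subnSK// subn0 natrB; last by lia.
  rewrite natrB// => e.
  have k1 : 1 <= k%:R :> R by rewrite (ler_nat _ 1).
  have c0 : 0 < (n%:R - (k%:R - 1)) * p by rewrite mulr_gt0//; lra.
  by rewrite -(ler_pM2l c0) -e ler_wpM2r//; lra.
have e1 := @binomial_pmf_ratio R n p (k - j.+2).
have e2 := @binomial_pmf_ratio R n p (k + j).
move: e1 e2; rewrite subnSK//.
have jk' : j.+1%:R < k%:R :> R by rewrite ltr_nat.
have j0 : 0 < j.+1%:R :> R by rewrite ltr0n.
have -> : (n - (k - j.+2))%:R = n%:R - k%:R + 1 + j.+1%:R :> R.
  by rewrite !natrB -1?[j.+2%:R]natr1; [ring|lia..].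
have -> : (n - (k + j))%:R = n%:R - k%:R + 1 - j.+1%:R :> R.
  by rewrite natrB ?natrD -1?[j.+1%:R]natr1; [ring|lia].
have -> : (k - j.+1)%:R = k%:R - j.+1%:R :> R by rewrite natrB// ltnW.
have -> : (k + j).+1%:R = k%:R + j.+1%:R :> R by rewrite -addnS natrD.
rewrite addnS.
move=> /(_ ltac:(lia)) e1 /(_ ltac:(lia)) e2.
have {IH} := IH (ltnW jk).
move: (b0 (k - j.+1)%N) (b0 (k + j)%N) e1 e2.
move: (binomial_pmf n p (k - j.+1)) (binomial_pmf n p (k + j)) => L' H'.
move: (binomial_pmf n p (k - j.+2)) (binomial_pmf n p (k + j).+1) => L H.
move: knp KX jk' j0.
move: k%:R n%:R j.+1%:R => K N i knp KX iK i0 L0 H0 e1 e2 LH.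
set X := N - K + 1 in KX e1 e2 *.
(* The comparison of the two step ratios with denominators cleared. For [p <= 1 - p] it is the
   difference of [h2] and [h3]; otherwise it holds factor by factor, since [K <= X] and
   [1 - p < p]. *)
have ineq : (K ^+ 2 - i ^+ 2) * (1 - p) ^+ 2 <= (X ^+ 2 - i ^+ 2) * p ^+ 2.
  have h : K * (1 - p) <= X * p by rewrite /X; lra.
  have [pq|pq] := leP p (1 - p).
    have h2 : (K * (1 - p)) ^+ 2 <= (X * p) ^+ 2.
      by rewrite ler_sqr ?nnegrE ?mulr_ge0//; lra.
    have h3 : (i * p) ^+ 2 <= (i * (1 - p)) ^+ 2.
      by rewrite ler_sqr ?nnegrE ?mulr_ge0 ?ler_wpM2l//; lra.
    rewrite !mulrBl -!exprMn; lra.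
  apply: ler_pM.
  - by rewrite subr_ge0 ler_sqr ?nnegrE; lra.
  - exact: sqr_ge0.
  - by rewrite lerD2r ler_sqr ?nnegrE; lra.
  - by rewrite ler_sqr ?nnegrE; lra.
rewrite -(ler_pM2l (_ : 0 < (X + i) * p * ((K + i) * (1 - p)))); last first.
  by rewrite !mulr_gt0//; lra.
have -> : (X + i) * p * ((K + i) * (1 - p)) * L
  = (K ^+ 2 - i ^+ 2) * (1 - p) ^+ 2 * L'.
  transitivity ((K + i) * (1 - p) * ((X + i) * p * L)); first by ring.
  by rewrite -e1; ring.
have -> : (X + i) * p * ((K + i) * (1 - p)) * H
  = (X ^+ 2 - i ^+ 2) * p ^+ 2 * H'.
  transitivity ((X + i) * p * ((K + i) * (1 - p) * H)); first by ring.
  by rewrite e2; ring.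
apply: ler_pM => //.
by rewrite mulr_ge0 ?sqr_ge0// subr_ge0 ler_sqr ?nnegrE; lra.
Qed.

(** [s - j.+1] and [D j] never have opposite signs, so [s * D j] is at least [j.+1 * D j] for each
    [j]. *)
Lemma sum_ge0_single_crossing (R : realFieldType) (k s : nat) (D : nat -> R) :
  (0 < s)%N ->
  (forall j, (j < k)%N -> (j.+1 < s)%N -> 0 <= D j) ->
  (forall j, (j < k)%N -> (s <= j.+1)%N -> D j <= 0) ->
  0 <= \sum_(j < k) j.+1%:R * D j -> 0 <= \sum_(j < k) D j.
Proof.
move=> s0 Dlt Dge mean0.
have s0' : 0 < s%:R :> R by rewrite ltr0n.
rewrite -(pmulr_rge0 _ s0') (le_trans mean0)// -subr_ge0 mulr_sumr -sumrB.
apply: sumr_ge0 => j _; rewrite -mulrBl.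
have [js|sj] := ltnP j.+1 s.
  by rewrite mulr_ge0 ?Dlt// subr_ge0 ler_nat ltnW.
by rewrite mulr_le0 ?Dge// subr_le0 ler_nat.
Qed.

(* The ratio of [b (k + j)] to [b (k - j)] is unimodal in [j] and starts at 1,
   so their difference changes sign at most once. *)
Lemma binomial_pmf_crossing (R : realType) (n k : nat) (p : R) :
  0 < p < 1 -> k%:R <= n%:R * p -> (n < k.*2)%N -> (k <= n)%N ->
  exists2 s, (0 < s)%N &
    (forall j, (j < s)%N -> (j <= k)%N ->
       binomial_pmf n p (k - j) <= binomial_pmf n p (k + j)) /\
    (forall j, (s <= j)%N -> (j <= k)%N ->
       binomial_pmf n p (k + j) <= binomial_pmf n p (k - j)).
Proof.
move=> /andP[p0 p1] knp n2k kn.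
have q0 : 0 < 1 - p by rewrite subr_gt0.
have b0 i : 0 <= binomial_pmf n p i by rewrite binomial_pmf_ge0// !ltW.
(* [n p >= k > n / 2] forces [p > 1 / 2]. *)
have p2 : 1 - p < p.
  have n2k' : n%:R < 2 * k%:R :> R by rewrite -natrM mul2n ltr_nat.
  rewrite ltNge; apply/negP => pq.
  have : n%:R * (2 * p) <= n%:R by rewrite ler_piMr//; lra.
  lra.
have pq2 : (1 - p) ^+ 2 <= p ^+ 2 by rewrite ler_sqr ?nnegrE; lra.
(* The crossing index [s] is the first [i] whose right mass is below the left one, or [k.+1] if
   there is none. *)
have [/existsP[i0 Pi0]|/existsPn none] := boolP [exists i : 'I_k.+1,
    binomial_pmf n p (k + i) < binomial_pmf n p (k - i)]; last first.
  exists k.+1 => //; split=> j jk; last by lia.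
  by move=> _; have := none (Ordinal jk); rewrite -leNgt.
pose P i := (i <= k)%N && (binomial_pmf n p (k + i) < binomial_pmf n p (k - i)).
have exP : exists i, P i by exists i0; rewrite /P Pi0 -ltnS ltn_ord.
case: (ex_minnP exP) => s /andP[sk Ps] smin.
have s0 : (0 < s)%N by case: s Ps {sk smin} => //; rewrite addn0 subn0 ltxx.
have before j : (j < s)%N -> (j <= k)%N ->
    binomial_pmf n p (k - j) <= binomial_pmf n p (k + j).
  move=> js jk; rewrite leNgt; apply/negP => bj.
  by have := smin j; rewrite /P jk bj => /(_ isT); rewrite leqNgt js.
exists s => //; split=> //.
(* Going from [j] to [j.+1] multiplies the right mass by [up j.+1 / c j] and the left one by
   [down j.+1 / c j]. *)
pose up (j : nat) : R :=
  p ^+ 2 * ((n%:R - k%:R + 1 - j%:R) * (n%:R - k%:R + j%:R)).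
pose down (j : nat) : R := (1 - p) ^+ 2 * ((k%:R + j%:R) * (k%:R + 1 - j%:R)).
pose c (j : nat) : R :=
  (n%:R - k%:R + j.+1%:R) * p * ((k%:R + j.+1%:R) * (1 - p)).
have knR : k%:R <= n%:R :> R by rewrite ler_nat.
have k0 : 0 <= k%:R :> R by [].
have c0 j : 0 < c j.
  have ? : 0 < j.+1%:R :> R by rewrite ltr0n.
  by rewrite /c !mulr_gt0//; lra.
have down0 j : (j < k)%N -> 0 <= down j.+1.
  rewrite -(ler_nat R) => jk; rewrite /down mulr_ge0 ?sqr_ge0// mulr_ge0//.
  by lra.
have stepL j : (j < k)%N -> c j * binomial_pmf n p (k - j.+1)
    = down j.+1 * binomial_pmf n p (k - j).
  move=> jk; have := @binomial_pmf_ratio R n p (k - j.+1) ltac:(lia).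
  rewrite subnSK// natrB 1?ltnW// natrB; last by lia.
  rewrite natrB// => e.
  transitivity ((k%:R + j.+1%:R) * (1 - p) *
    ((n%:R - (k%:R - j.+1%:R)) * p * binomial_pmf n p (k - j.+1))).
    by rewrite /c; ring.
  by rewrite -e /down -natr1; ring.
have stepH j : (k + j <= n)%N -> c j * binomial_pmf n p (k + j.+1)
    = up j.+1 * binomial_pmf n p (k + j).
  move=> kjn; have := binomial_pmf_ratio p kjn.
  rewrite -addnS natrD natrB// natrD => e.
  transitivity ((n%:R - k%:R + j.+1%:R) * p *
    ((k%:R + j.+1%:R) * (1 - p) * binomial_pmf n p (k + j.+1))).
    by rewrite /c; ring.
  by rewrite e /up -natr1; ring.
(* Before [s] the right mass was still at least the left one; a strictly larger factor could not
   have reversed this. Beyond the support, [up s <= 0]. *)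
have up_s : up s <= down s.
  case: s s0 sk Ps before {smin} => // j _ jk Pj /(_ j (ltnSn j) (ltnW jk)) bj.
  have [kjn|nkj] := leqP (k + j) n; last first.
    rewrite (@le_trans _ _ 0) ?down0// /up mulr_ge0_le0 ?sqr_ge0//.
    have : n.+1%:R <= (k + j)%:R :> R by rewrite ler_nat.
    rewrite natrD -!natr1 => h; rewrite mulr_le0_ge0//; first by lra.
    by have : 0 <= j%:R :> R by []; lra.
  rewrite leNgt; apply/negP => gt1.
  move: Pj; rewrite ltNge => /negP; apply.
  rewrite -(ler_pM2l (c0 j)) stepL// stepH//.
  by rewrite ler_pM ?down0// ltW.
(* [down j - up j] is a constant plus [(p ^+ 2 - (1 - p) ^+ 2) * (j * (j - 1))], hence nondecreasing
   for [j >= 1]. *)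
have up_ge j : (s <= j)%N -> up j <= down j.
  move=> sj; move: up_s.
  have : s%:R * (s%:R - 1) <= j%:R * (j%:R - 1) :> R.
    have sjR : s%:R <= j%:R :> R by rewrite ler_nat.
    have s1 : 1 <= s%:R :> R by rewrite (ler_nat _ 1).
    by rewrite ler_pM//; lra.
  rewrite -subr_ge0 /up /down => h.
  have : 0 <= (p ^+ 2 - (1 - p) ^+ 2)
    * (j%:R * (j%:R - 1) - s%:R * (s%:R - 1)) by rewrite mulr_ge0// subr_ge0.
  by rewrite -subr_ge0 => h1; rewrite -subr_ge0 => h2; nra.
elim=> [|j IH]; first by rewrite leqn0 => /eqP s00; rewrite s00 in s0.
rewrite leq_eqVlt => /predU1P[<- _|sj jk]; first exact: ltW.
have [kjn|nkj] := leqP (k + j) n; last first.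
  by rewrite binomial_pmf_gt// addnS ltnS ltnW.
rewrite -(ler_pM2l (c0 j)) stepL// stepH//.
apply: le_trans (ler_wpM2l (down0 j jk) (IH sj (ltnW jk))).
by rewrite ler_wpM2r// up_ge// ltnW.
Qed.

Lemma binomial_median (R : realType) (n k : nat) (p : R) :
  0 < p < 1 -> k%:R <= n%:R * p -> \sum_(m < k) binomial_pmf n p m <= 1 / 2.
Proof.
move=> p01 knp; have /andP[p0 p1] := p01.
have b0 i : 0 <= binomial_pmf n p i by rewrite binomial_pmf_ge0// !ltW.
have kn : (k <= n)%N.
  by rewrite -(ler_nat R) (le_trans knp)// ler_piMr// ltW.
rewrite sum_ord_rev ler_pdivlMr// mulr_natr mulr2n -[leRHS](binomial_sum1 n p).
have [k2n|n2k] := leqP k.*2 n.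
  (* The block from [k] to [2 k - 1] dominates the mirrored block below [k]. *)
  have -> : n.+1 = (k + (k + (n.+1 - k.*2)))%N by lia.
  rewrite !big_split_ord/= sum_ord_rev lerD2l ler_wpDr ?sumr_ge0//.
  by apply: ler_sum => j _; exact: binomial_pmf_reflect.
(* Masses beyond [n] vanish, so sums may run over the window [0..2k], symmetric about [k]. *)
have widen (g : nat -> R) : (forall m, (n < m)%N -> g m = 0) ->
    \sum_(m < n.+1) g m = \sum_(m < k.*2.+1) g m.
  move=> g0; have -> : k.*2.+1 = (n.+1 + (k.*2 - n))%N by lia.
  rewrite big_split_ord/= [X in _ + X]big1 ?addr0// => i _.
  by rewrite g0// ltnS leq_addr.
rewrite widen; last exact: binomial_pmf_gt.
rewrite (sum_ord_central k (binomial_pmf n p)).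
rewrite ler_wpDl// -subr_ge0 -big_split/= -sumrB.
have [s s0 [lt_s ge_s]] := binomial_pmf_crossing p01 knp n2k kn.
pose D j := binomial_pmf n p (k + j.+1) - binomial_pmf n p (k - j.+1).
rewrite (eq_bigr (fun j : 'I_k => D j)) => [|j _]; last by rewrite /D; ring.
apply: (sum_ge0_single_crossing s0) => [j jk js|j jk sj|].
- by rewrite subr_ge0 lt_s.
- by rewrite subr_le0 ge_s.
(* Folded about [k], the first moment [n p - k] becomes the sum of [j.+1 * D j]. *)
have : 0 <= n%:R * p - k%:R by rewrite subr_ge0.
rewrite -binomial_mean (widen (fun m => (m%:R - k%:R) * binomial_pmf n p m)).
rewrite (sum_ord_central k (fun m => (m%:R - k%:R) * binomial_pmf n p m)).
rewrite subrr mul0r add0r (eq_bigr (fun j : 'I_k => j.+1%:R * D j))// => j _.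
by rewrite natrD natrB// /D; ring.
by move=> m nm; rewrite binomial_pmf_gt ?mulr0.
Qed.

(** * The number of perished units is binomial *)

Lemma expectation_fin_image d (Omega : measurableType d) (R : realType)
    (P : probability Omega R) (I : finType) (N : Omega -> I) (g : I -> R) :
  (forall i, measurable (N @^-1` [set i])) ->
  ('E_P[fun w => g (N w)] = \sum_i (g i)%:E * P (N @^-1` [set i]))%E.
Proof.
move=> mN.
have L1 i : (\1_(N @^-1` [set i]) : Omega -> R) \in Lfun P 1.
  exact/Lfun1_integrable/integrable_indic.
(* [g (N w)] is a finite combination of indicators of the fibres of [N]. *)
have -> : (fun w => g (N w))
    = \sum_(f <- [seq g i \o* \1_(N @^-1` [set i]) | i <- enum I]) f.
  apply/funext => w; rewrite big_map fct_sumE big_enum (bigD1 (N w))//=.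
  rewrite indicE mem_set// mul1r big1 ?addr0// => i iNw.
  by rewrite indicE memNset ?mul0r// => /= e; rewrite e eqxx in iNw.
rewrite expectation_sum => [|f /mapP[i _ ->]]; last exact: Lfun_scale.
rewrite big_map big_enum; apply: eq_bigr => i _.
by rewrite expectationZl// expectation_indic.
Qed.

Section PerishedLaw.
Context d (Omega : measurableType d) (R : realType) (P : probability Omega R).
Context (U : finType) (perish : U -> {RV P >-> nat}) (t : nat).

(** The whole set of perished units is tracked, not just its size: independence gives the
    probability of each of its values as a product over the units. *)
Let perished (w : Omega) : {set U} := finset (fun b => perish b w < t)%N.

Let perishedE w : perished_before perish t w = #|perished w|.
Proof.
rewrite /perished_before -sum1_card [RHS]big_mkcond/=.
by apply: eq_bigr => b _; rewrite inE; case: ltnP.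
Qed.

Let side (J : {set U}) (b : U) : set nat :=
  if b \in J then [set x | (x < t)%N] else ~` [set x | (x < t)%N].

Let perished_preimage (J : {set U}) : perished @^-1` [set J] =
  [set w | forall b, b \in finset.setT -> side J b (perish b w)].
Proof.
apply/seteqP; split=> [w <- b _|w h] /=; rewrite /side.
  by rewrite inE; case: ifPn => // /negP.
apply/setP => b; rewrite inE; have := h b (finset.in_setT b); rewrite /side.
by case: ifPn => [_ ->|_ /negP/negbTE].
Qed.

Let measurable_side J b : measurable (perish b @^-1` side J b).
Proof. by rewrite -[_ @^-1` _]setTI; exact: measurable_funP. Qed.

Let measurable_perished J : measurable (perished @^-1` [set J]).
Proof.
rewrite perished_preimage.
rewrite (_ : mkset _ = \bigcap_(b in [set: U]) (perish b @^-1` side J b)).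
  by apply: fin_bigcap_measurable => //; exact: finite_finset.
by apply/seteqP; split=> w /= h b ?; apply: h.
Qed.

Context (p : R) (indep : mutually_independent perish)
  (probE : forall b, P [set w | (perish b w < t)%N] = p%:E).

Let perished_prob (J : {set U}) :
  P (perished @^-1` [set J]) = (p ^+ #|J| * (1 - p) ^+ (#|U| - #|J|))%:E.
Proof.
rewrite perished_preimage indep//.
rewrite (eq_bigr (fun b => (if b \in J then p else 1 - p)%:E)) => [|b _].
  rewrite prodEFin (eq_bigl xpredT) => [|b]; last exact: finset.in_setT.
  rewrite (bigID (mem J))/= (eq_bigr (fun=> p)) => [|b ->//].
  rewrite [X in _ * X](eq_bigr (fun=> 1 - p)) => [|b /negbTE ->//].
  by rewrite !prodr_const -(cardC (mem J)) addKn.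
rewrite /side; case: ifPn => _; first exact: probE.
rewrite preimage_setC probability_setC; last first.
  exact: (measurable_funPTI (perish b) (Y:=`I_t)).
by rewrite probE.
Qed.

Lemma expectation_perished_before (g : nat -> R) :
  ('E_P[fun w => g (perished_before perish t w)])%E
  = (\sum_(k < #|U|.+1) g k * binomial_pmf #|U| p k)%:E.
Proof.
under eq_fun do rewrite perishedE.
rewrite (expectation_fin_image P (fun J : {set U} => g #|J|)
  measurable_perished).
under eq_bigr do rewrite perished_prob -EFinM.
rewrite sumEFin; congr _%:E.
(* Subsets are grouped by size; [inord] loses nothing, as no size exceeds [#|U|]. *)
rewrite (partition_big (fun J : {set U} => inord #|J| : 'I_#|U|.+1) xpredT)//=.
apply: eq_bigr => k _.
have cardJ (J : {set U}) : ((inord #|J| : 'I_#|U|.+1) == k) = (#|J| == k).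
  by rewrite -val_eqE/= inordK// ltnS max_card.
rewrite (eq_bigl _ _ cardJ).
rewrite (eq_bigr (fun=> g k * (p ^+ k * (1 - p) ^+ (#|U| - k)))).
  rewrite -mulr_sumr; congr (_ * _).
  by rewrite sumr_const /binomial_pmf -card_draws cardsE.
by move=> J /eqP ->.
Qed.

Lemma measurable_perished_before :
  measurable_fun [set: Omega] (perished_before perish t).
Proof.
move=> _ A _; rewrite setTI.
rewrite (_ : _ @^-1` A = \bigcup_(J in [set J : {set U} | A #|J|])
    (perished @^-1` [set J])).
  by apply: fin_bigcup_measurable => //; exact: finite_finset.
apply/seteqP; split=> w /=.
  by rewrite perishedE => Aw; exists (perished w).
by move=> [J /= AJ eJ]; rewrite perishedE eJ.
Qed.

End PerishedLaw.

Lemma probability_perished_before_lt d (Omega : measurableType d)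
    (R : realType) (P : probability Omega R) (U : finType)
    (perish : U -> {RV P >-> nat}) (t : nat) (p : R) (m : nat) :
  mutually_independent perish ->
  (forall b, P [set w | (perish b w < t)%N] = p%:E) -> (m <= #|U|.+1)%N ->
  P [set w | (perished_before perish t w < m)%N]
  = (\sum_(k < m) binomial_pmf #|U| p k)%:E.
Proof.
move=> indep probE mU.
rewrite -expectation_indic; last first.
  rewrite -[X in measurable X]setTI.
  exact: (measurable_perished_before perish t measurableT (Y := `I_m)).
rewrite (_ : \1__ = fun w => (perished_before perish t w < m)%N%:R); last first.
  apply/funext => w; rewrite indicE; congr (_%:R); congr nat_of_bool.
  by apply/idP/idP; rewrite inE.
rewrite (expectation_perished_before indep probE (fun k => (k < m)%N%:R)).
congr _%:E; rewrite (big_ord_widen _ (binomial_pmf #|U| p) mU) [RHS]big_mkcond.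
by apply: eq_bigr => k _; case: ifPn => _; rewrite ?mul1r ?mul0r.
Qed.

(** * Offset expiry under unit arrivals *)

Lemma arrivals_before_unit d (Omega : measurableType d) (R : realType)
    (P : probability Omega R) (arr : nat -> {RV P >-> nat}) (t : nat) w :
  (forall s, (1 <= s < t)%N -> arr s w = 1%N) ->
  arrivals_before arr t w = t.-1.
Proof.
move=> arr1; rewrite /arrivals_before big_nat_cond.
rewrite (eq_bigr (fun=> 1%N)) => [|s /andP[/arr1]//].
by rewrite -big_nat_cond sum_nat_const_nat muln1 subn1.
Qed.

Lemma measurable_arrivals_before d (Omega : measurableType d) (R : realType)
    (P : probability Omega R) (arr : nat -> {RV P >-> nat}) (t : nat) :
  measurable_fun [set: Omega] (arrivals_before arr t).
Proof.
rewrite /arrivals_before; elim: (index_iota 1 t) => [|s r IH].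
  by under eq_fun do rewrite big_nil; exact: measurable_cst.
under eq_fun do rewrite big_cons.
exact: measurable_fun_addn.
Qed.

(** Almost surely [t - 1] individuals arrive before [t] and [T = #|U|] in total, so the condition at
    round [t] says that at most [t - 1] units have perished. *)
Lemma offset_expiring_probability d (Omega : measurableType d) (R : realType)
    (P : probability Omega R) (T : nat) (U : finType)
    (arr : nat -> {RV P >-> nat}) (perish : U -> {RV P >-> nat}) (delta : R)
    (t : nat) :
  (0 < #|U|)%N -> #|U| = T ->
  (forall s : nat, (1 <= s <= T)%N -> {ae P, forall w, arr s w = 1%N}) ->
  (2 <= t <= T)%N -> offset_expiring T arr perish delta ->
  ((1 - delta)%:E <= P [set w | (perished_before perish t w < t)%N])%E.
Proof.
move=> U0 cardU arr1 tT; rewrite /offset_expiring.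
set E := (X in P X) => h; apply: (le_trans h) => {h}.
have mnat (f : nat -> R) (X : Omega -> nat) : measurable_fun [set: Omega] X ->
    measurable_fun [set: Omega] (fun w => f (X w)).
  by move=> mX; apply: (measurableT_comp (f := f)).
have mE : measurable E.
  rewrite (_ : E = \bigcap_(s in [set s | (2 <= s <= T)%N]) [set w |
      (perished_before perish s w)%:R / #|U|%:R
      <= (arrivals_before arr s w)%:R / (total_arrivals T arr w)%:R :> R]).
    apply: bigcap_measurable; first by exists t.
    move=> s _; rewrite -[X in measurable X]setTI.
    apply: (measurable_fun_ler _ _ measurableT (Y := [set true])) => //.
      apply: measurable_funM => //.
      by apply: (mnat (fun n => n%:R)); exact: measurable_perished_before.
    apply: measurable_funM => //.
      by apply: (mnat (fun n => n%:R)); exact: measurable_arrivals_before.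
    by apply: (mnat (fun n => n%:R^-1)); exact: measurable_arrivals_before.
  by apply/seteqP; split=> w /= Ew s; exact: Ew.
(* Countably many almost sure statements are merged; rounds outside [1..T] hold vacuously. *)
have : {ae P, forall w, forall s, (1 <= s <= T)%N -> arr s w = 1%N}.
  apply/ae_foralln => s; have [sT|sT] := boolP (1 <= s <= T)%N.
    by apply: filterS (arr1 s sT) => w ->.
  by apply: aeW.
move=> [N [mN PN0 arrN]].
set F := [set w | _].
have mF : measurable F.
  rewrite -[X in measurable X]setTI.
  exact: (measurable_perished_before perish t measurableT (Y := `I_t)).
have EFN : E `<=` F `|` N.
  move=> w Ew; have [Nw|Nw] := pselect (N w); [by right|left].
  have {}arr1 : forall s, (1 <= s <= T)%N -> arr s w = 1%N.
    by apply: contrapT => h; apply: Nw; exact: arrN.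
  have := Ew t tT; rewrite /total_arrivals !arrivals_before_unit.
  - rewrite cardU ler_pM2r ?invr_gt0 ?ltr0n -?cardU// ler_nat /F/=.
    by case: t tT {mF F} => // t _ h; rewrite ltnS.
  - by move=> s /andP[s1 st]; apply: arr1; lia.
  - by move=> s /andP[s1 st]; apply: arr1; lia.
apply: (@le_trans _ _ (P (F `|` N))).
  by apply: le_measure => //; rewrite inE//; exact: measurableU.
by rewrite measureU0.
Qed.

(** * From the binomial estimates to the threshold for [delta] *)

Theorem proposition1 (d : measure_display) (Omega : measurableType d)
    (R : realType) (P : probability Omega R)
    (T : nat) (U : finType) (cardU : #|U| = T)
    (arr : nat -> {RV P >-> nat})
    (arr1 : forall s : nat, (1 <= s <= T)%N -> {ae P, forall w, arr s w = 1%N})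
    (perish : U -> {RV P >-> nat})
    (perish_ge1 : forall (b : U) (w : Omega), (1 <= perish b w)%N)
    (perish_iid : iid perish)
    (t : nat) (t_ge2 : (2 <= t)%N)
    (mean_gt : ((t%:R - 1)%:E
                < 'E_P[fun w => (perished_before perish t w)%:R])%E) :
  (rand_units perish t = set0 ->
     forall delta : R, 0 < delta < 1 -> ~ offset_expiring T arr perish delta)
  /\
  (rand_units perish t <> set0 ->
     forall delta : R, 0 < delta < 1 ->
       delta < 1 / 2
         - (std P (fun w => (perished_before perish t w)%:R)) ^- 3 * T%:R ->
       ~ offset_expiring T arr perish delta).
Proof.
have [indep ident] := perish_iid.
have [p [/andP[p0 p1] probE]] : exists p : R, 0 <= p <= 1 /\
    forall b, P [set w | (perish b w < t)%N] = p%:E.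
  (* Without units the claim on [b] is vacuous and [p] takes the default value 0. *)
  have [b _|U0] := pickP (@predT U); last first.
    by exists 0; rewrite lexx ler01; split=> // b; have := U0 b.
  have Pfin : (P [set w | (perish b w < t)%N] \is a fin_num)%E.
    apply: fin_num_measure.
    exact: (measurable_funPTI (perish b) (Y := `I_t)).
  exists (fine (P [set w | (perish b w < t)%N])); split=> [|b'].
    by rewrite fine_ge0//= -lee_fin fineK// probability_le1//;
      exact: (measurable_funPTI (perish b) (Y := `I_t)).
  by rewrite fineK//; exact: (ident b' b `I_t).
have meanE : ('E_P[fun w => (perished_before perish t w)%:R])%E
    = (#|U|%:R * p)%:E.
  rewrite (expectation_perished_before indep probE (fun k => k%:R)).
  rewrite -[X in X%:E = _]subr0 -[in RHS](subr0 (_ * p)) -binomial_mean.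
  by rewrite subr0; congr _%:E; apply: eq_bigr => k _; rewrite subr0.
move: mean_gt; rewrite meanE lte_fin => tUp.
have U_ge_Up : #|U|%:R * p <= #|U|%:R by rewrite ler_piMr.
(* [t - 1 < #|U| p <= #|U|] puts round [t] within the horizon, where offset expiry constrains it. *)
have tT : (t <= #|U|)%N.
  by rewrite -ltnS -(ltr_nat R) -natr1; lra.
have U0 : (0 < #|U|)%N by rewrite (leq_trans _ tT)// ltnW.
have t2 : 2 <= t%:R :> R by rewrite (ler_nat _ 2).
have offset (delta : R) : offset_expiring T arr perish delta ->
    1 - delta <= \sum_(k < t) binomial_pmf #|U| p k.
  move=> /(offset_expiring_probability U0 cardU arr1 (t := t)).
  rewrite -cardU t_ge2 tT => /(_ isT).
  by rewrite (probability_perished_before_lt indep probE) ?lee_fin// leqW.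
have p_gt0 : 0 < p.
  by rewrite lt_def p0 andbT; apply/eqP => p00; move: tUp; rewrite p00; lra.
have [b0 _] : exists b : U, true by move/card_gt0P : U0 => [b _]; exists b.
split=> [rand0|randN0] delta /andP[d0 d1].
  (* No unit is random and [p > 0], so every unit has perished almost surely and the masses below
     [#|U|] vanish; this would force [1 - delta <= 0]. *)
  have p1E : p = 1.
    apply/eqP; rewrite eq_le p1 leNgt/=; apply/negP => plt1.
    have : rand_units perish t b0.
      by rewrite /rand_units/= probE !lte_fin p_gt0.
    by rewrite rand0.
  move=> /offset; rewrite big1 => [|k _]; first by lra.
  rewrite binomial_pmfE p1E subrr expr0n.
  by rewrite subn_eq0 leqNgt (leq_trans (ltn_ord k) tT) mulr0.
have p_lt1 : p < 1.
  have /set0P[b] : rand_units perish t != set0 by apply/eqP.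
  by rewrite /rand_units/= probE !lte_fin => /andP[].
have v0 : 0 < #|U|%:R * p * (1 - p) by rewrite !mulr_gt0 ?ltr0n ?subr_gt0.
have -> : std P (fun w => (perished_before perish t w)%:R)
    = Num.sqrt (#|U|%:R * p * (1 - p)).
  rewrite /std /variance unlock meanE /=.
  rewrite (_ : _ * _ =
      fun w => ((perished_before perish t w)%:R - #|U|%:R * p) ^+ 2) //.
  rewrite (expectation_perished_before indep probE
    (fun k => (k%:R - #|U|%:R * p) ^+ 2)).
  by rewrite binomial_variance subrr expr0n addr0.
set s := Num.sqrt _ => ds /offset; apply/negP; rewrite -ltNge.
have s0 : 0 < s by rewrite sqrtr_gt0.
have t1U : (t.-1 <= #|U|)%N by rewrite (leq_trans (leq_pred t)).
have tE : t = t.-1.+1 by rewrite prednK// ltnW.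
have t1Up : t.-1%:R <= #|U|%:R * p by rewrite tE -natr1 in tUp; lra.
have p01 : 0 < p < 1 by rewrite p_gt0.
have med := binomial_median p01 t1Up.
have pmf_le := binomial_pmf_le U0 p01 t1U.
(* The variance [s ^+ 2] is at most [T]. *)
have s3 : s^-1 <= s ^- 3 * T%:R.
  have -> : s^-1 = s ^- 3 * s ^+ 2 by field; rewrite gt_eqF.
  apply: ler_wpM2l; first by rewrite invr_ge0 exprn_ge0 ?ltW.
  rewrite sqr_sqrtr ?(ltW v0)// -cardU.
  by rewrite (le_trans _ U_ge_Up)// ler_piMr ?mulr_ge0//; lra.
rewrite -/s in pmf_le.
(* The masses below [t - 1] sum to at most [1 / 2] and the one at [t - 1] is at most [s^-1]; the
   total is below [1 - delta]. *)
rewrite tE big_ord_recr/=; lra.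
Qed.
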